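(* Let $\theta\ge2$. There is a constant $C_\theta>0$ such that for every integer $N>1$ and every $(t,x)\in[-N^{-(\theta-1)},N^{-(\theta-1)}]\times\mathbb T$ with $t\neq0$, $$\Big|\sum_{\xi=-N}^{N}e^{2\pi i(x\xi+t|\xi|^\theta)}\Big|\le C_\theta\,|t|^{-1/\theta}.$$
   Context: $\mathbb T=\mathbb R/\mathbb Z$; the sum is over integers $\xi$ with $-N\le\xi\le N$. *)

(* Defs.v *)
From HB Require Import structures.
From mathcomp Require Import all_boot all_order all_algebra.
From mathcomp Require Import complex.
From mathcomp Require Import reals.
From mathcomp.analysis Require Import sequences exp trigo.

Set Implicit Arguments.
Unset Strict Implicit.
Unset Printing Implicit Defensive.

Import Order.TTheory GRing.Theory Num.Theory.
Local Open Scope ring_scope.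
Local Open Scope complex_scope.

(* The complex exponential: e^(a + ib) = e^a (cos b + i sin b). *)
Definition cexp (R : realType) (z : R[i]) : R[i] :=
  let: a +i* b := z in (expR a)%:C * (cos b +i* sin b).

(* The index i in {0, ..., 2N} stands for the frequency xi = i - N, so that xi
   ranges over the integers -N <= xi <= N. A point of the torus R/Z is given by
   a real representative x: each summand is 1-periodic in x as xi is an
   integer. The value at xi = 0 is cexp 0 when theta != 0, as then
   0 `^ theta = 0. *)
Definition exp_sum (R : realType) (theta : R) (N : nat) (t x : R) : R[i] :=
  \sum_(i < (2 * N).+1)
     let xi : R := (i%:Z - N%:Z)%:~R in
     cexp (0 +i* (2 * pi * (x * xi + t * `|xi| `^ theta))).

(* Main.v *)
(** By symmetry it suffices to bound sums of [cos (2 pi f n)] over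
    [0 <= n <= N] with [f n = c + x n + t n^theta] and [t > 0]; sines are
    cosines with the phase [c] shifted by [-1/4]. Put [L = t^(-1/theta) >= 1].
    The terms with [n <= L] are bounded trivially. For [n >= L] the increments of
    [f] grow by at least [t L^(theta - 2) = L^-2] at each step, while all of them
    lie in an interval of length at most [theta] because [t N^(theta - 1) <= 1].
    Hence they come within [1/(2L)] of an integer only [O(L)] times, and on each
    of the [O(theta)] remaining runs the Kusmin-Landau inequality gives a bound
    [O(L)]. *)
Require Import Defs.
From HB Require Import structures.
From mathcomp Require Import all_boot all_order all_algebra.
From mathcomp Require Import complex.
From mathcomp Require Import ring lra zify.
From mathcomp Require Import reals.
From mathcomp.analysis Require Import sequences exp trigo.
From mathcomp Require Import classical_sets topology normedtype derive.

Set Implicit Arguments.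
Unset Strict Implicit.
Unset Printing Implicit Defensive.

Import Order.TTheory GRing.Theory Num.Theory.
Import numFieldNormedType.Exports.
Local Open Scope ring_scope.
Local Open Scope complex_scope.

(** * Periodicity of the cosine and bounds for the cotangent *)

Lemma cosD2piz (R : realType) (y : R) (z : int) : cos (y + 2 * pi * z%:~R) = cos y.
Proof.
have cosn (n : nat) v : cos (v + 2 * pi * n%:R) = cos v :> R.
  by rewrite -[RHS](periodicn (@cosD2pi R) n) -[_ *+ n]mulr_natr
    -[pi *+ 2]mulr_natr; congr cos; ring.
case: z => n; first exact: cosn.
rewrite -[LHS](cosn n.+1); congr cos.
by rewrite NegzE mulrNz mulrN subrK.
Qed.

Lemma mul_cos_le_sin (R : realType) (y : R) : 0 <= y <= pi -> y * cos y <= sin y.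
Proof.
move=> /andP[y0 ypi].
have dF (x : R) : is_derive x 1 (fun z => sin z - z * cos z) (x * sin x).
  apply: is_derive_eq; rewrite /GRing.scale /=; ring.
have cF : {within `[0, y], continuous (fun z => sin z - z * cos z)}%classic.
  apply: derivable_within_continuous => x _; exact: (@ex_derive _ _ _ _ _ _ _ (dF x)).
have [c + E] := MVT_segment y0 (fun x _ => dF x) cF.
rewrite in_itv /= => /andP[c0 cy].
move: E; rewrite sin0 mul0r subr0 !subr0 => E.
rewrite -subr_ge0 E mulr_ge0 // mulr_ge0 // sin_ge0_pi // c0.
exact: le_trans cy ypi.
Qed.

Lemma cot_le_inv (R : realType) (y : R) : 0 < y < pi -> cos y / sin y <= y^-1.
Proof.
move=> /andP[y0 ypi].
rewrite ler_pdivrMr ?sin_gt0_pi ?y0 // -ler_pdivrMl ?invr_gt0 // invrK.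
by rewrite mul_cos_le_sin // !ltW.
Qed.

(** The reflection [y -> pi - y] changes the sign of the cotangent, so the lower bound follows from
    [cot_le_inv] at the reflected point. *)
Lemma norm_cot_le (R : realType) (l y : R) : 0 < l -> l <= y <= pi - l ->
  `|cos y / sin y| <= l^-1.
Proof.
move=> l0 /andP[ly yl].
have y0 : 0 < y by lra.
have ypi : y < pi by lra.
rewrite ler_norml; apply/andP; split; last first.
  by rewrite (le_trans (cot_le_inv _)) ?y0 // lef_pV2.
have -> : cos y / sin y = - (cos (pi - y) / sin (pi - y)).
  by rewrite cosB sinB cospi sinpi !mul0r addr0 sub0r !mulN1r opprK mulNr opprK.
rewrite lerN2 (le_trans (cot_le_inv _)) //; first lra.
by rewrite lef_pV2 ?posrE //; lra.
Qed.

Lemma cot_nincr (R : realType) (x y : R) : 0 < x -> x <= y -> y < pi ->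
  cos y / sin y <= cos x / sin x.
Proof.
move=> x0 xy ypi.
have sx : 0 < sin x by rewrite sin_gt0_pi // x0 (le_lt_trans xy).
have sy : 0 < sin y by rewrite sin_gt0_pi // ypi (lt_le_trans x0).
rewrite ler_pdivrMr // mulrAC ler_pdivlMr // -subr_ge0.
have -> : cos x * sin y - cos y * sin x = sin (y - x) by rewrite sinB; ring.
by rewrite sin_ge0_pi; lra.
Qed.

(** * Summation by parts and the Kusmin-Landau inequality *)

(** After summation by parts the two boundary terms cost [G] each, and the variation of the
    nonincreasing [g] telescopes to a difference of two values, at most [2 * G]. *)
Lemma abel_sum_le (R : realDomainType) (g s : nat -> R) (G : R) (a b : nat) :
  0 <= G ->
  (forall n, (a <= n)%N -> (n.+1 < b)%N -> g n.+1 <= g n) ->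
  (forall n, (a <= n < b)%N -> `|g n| <= G) ->
  (forall n, `|s n| <= 1) ->
  `|\sum_(a <= n < b) g n * (s n.+1 - s n)| <= 4 * G.
Proof.
move=> G0 gd gG s1.
have [ba|ab] := leqP b a; first by rewrite big_geq // normr0; lra.
have Hs k : (a + k < b)%N ->
  `|\sum_(a <= n < (a + k).+1) g n * (s n.+1 - s n) - g (a + k)%N * s (a + k).+1|
  <= G + g a - g (a + k)%N.
  elim: k => [|k IH] kb.
    rewrite addn0 in kb *; rewrite big_nat1 addrK.
    have -> : g a * (s a.+1 - s a) - g a * s a.+1 = - (g a * s a) by ring.
    by rewrite normrN normrM -[G]mulr1 ler_pM ?gG // leqnn.
  rewrite addnS in kb *.
  rewrite big_nat_recr /=; last by lia.
  set S := bigop _ _ _ in IH *.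
  have -> : S + g (a + k).+1 * (s (a + k).+2 - s (a + k).+1)
      - g (a + k).+1 * s (a + k).+2
    = (S - g (a + k)%N * s (a + k).+1)
      + (g (a + k)%N - g (a + k).+1) * s (a + k).+1 by ring.
  apply: le_trans (ler_normD _ _) _.
  have d0 : 0 <= g (a + k)%N - g (a + k).+1.
    by rewrite subr_ge0 gd // leq_addr.
  have : `|(g (a + k)%N - g (a + k).+1) * s (a + k).+1|
      <= g (a + k)%N - g (a + k).+1.
    by rewrite normrM (ger0_norm d0) ler_piMr.
  have := IH (ltnW kb); lra.
have [k kb] : exists k, b = (a + k).+1 by exists (b - a.+1)%N; lia.
have kb' : (a + k < b)%N by lia.
move/(_ _ kb'): Hs; rewrite -kb; set S := bigop _ _ _ => H.
have ga : `|g a| <= G by apply: gG; lia.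
have gk : `|g (a + k)%N| <= G by apply: gG; lia.
have gsk : `|g (a + k)%N * s b| <= G.
  by rewrite normrM -[G]mulr1 ler_pM.
move: H ga gk gsk; rewrite !ler_norml => /andP[? ?] /andP[? ?] /andP[? ?] /andP[? ?].
apply/andP; split; lra.
Qed.

(** Each cosine is half of a cotangent times an increment of the sine, up to a telescoping term.
    Increments of [f] at distance [l] from the integers keep the cotangent below [1 / (pi * l)], and
    their monotonicity makes it nonincreasing. Half of [4 / (pi * l)] from [abel_sum_le], plus half
    of a difference of two cosines, gives the constant. *)
Lemma kusmin_landau (R : realType) (f : nat -> R) (l : R) (a b : nat) : 0 < l ->
  (forall n, (a <= n)%N -> (n.+1 < b)%N ->
     f n.+1 - f n <= f n.+2 - f n.+1) ->
  (forall n, (a <= n < b)%N -> l <= f n.+1 - f n <= 1 - l) ->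
  `|\sum_(a <= n < b) cos (2 * pi * f n)| <= 1 + 2 / (pi * l).
Proof.
move=> l0 fc fl.
have pi0 := pi_gt0 R.
have l_pi : 0 < pi * l by rewrite mulr_gt0.
have gl0 : 0 < 2 / (pi * l) by rewrite divr_gt0.
have [ba|ab] := leqP b a.
  by rewrite big_geq // normr0; lra.
pose g n := cos (pi * (f n.+1 - f n)) / sin (pi * (f n.+1 - f n)).
pose c n := cos (2 * pi * f n); pose s n := sin (2 * pi * f n).
have dpi n : (a <= n < b)%N -> pi * l <= pi * (f n.+1 - f n) <= pi - pi * l.
  have -> : pi - pi * l = pi * (1 - l) by ring.
  by move=> /fl; rewrite !ler_pM2l.
(* This is [z = (z - w) / (1 - w / z)] for [z = e (f n)], [w = e (f n.+1)], in
   real parts, as [1 / (1 - e d) = (1 + i cot (pi d)) / 2]. *)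
have E n : (a <= n < b)%N ->
    c n = 2^-1 * (g n * (s n.+1 - s n)) - 2^-1 * (c n.+1 - c n).
  move=> /dpi /andP[d1 d2].
  have sn0 : sin (pi * (f n.+1 - f n)) != 0.
    by rewrite gt_eqF // sin_gt0_pi //; apply/andP; split; lra.
  rewrite /g /c /s.
  set d := pi * (f n.+1 - f n) in d1 d2 sn0 *.
  pose m := pi * (f n.+1 + f n).
  have -> : 2 * pi * f n.+1 = m + d by rewrite /m /d; ring.
  have -> : 2 * pi * f n = m - d by rewrite /m /d; ring.
  rewrite cosB cosD sinB sinD; by field.
rewrite (eq_big_nat _ _ E) big_split /= sumrN -!mulr_sumr telescope_sumr; last exact: ltnW.
have gS : `|\sum_(a <= n < b) g n * (s n.+1 - s n)| <= 4 * (pi * l)^-1.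
  apply: abel_sum_le => [|n an nb|n /dpi dn|n].
  - by rewrite invr_ge0 ltW.
  - have /dpi /andP[u1 u2] : (a <= n < b)%N by lia.
    have /dpi /andP[v1 v2] : (a <= n.+1 < b)%N by lia.
    apply: cot_nincr; [lra| |lra].
    by rewrite ler_pM2l //; exact: fc.
  - exact: norm_cot_le.
  - exact: sin_max.
have := cos_max (2 * pi * f a); have := cos_max (2 * pi * f b).
rewrite -/(c a) -/(c b); move: gS; rewrite !ler_norml.
move=> /andP[? ?] /andP[? ?] /andP[? ?]; apply/andP; split; lra.
Qed.

(** * Van der Corput's estimate from a lower bound on second differences *)

Lemma norm_sum_cos_le (R : realType) (f : nat -> R) (a b : nat) :
  `|\sum_(a <= n < b) cos (f n)| <= (b - a)%:R.
Proof.
apply: le_trans (ler_norm_sum _ _ _) _.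
rewrite -[leRHS]mulr1 mulr_natl -sumr_const_nat.
by apply: ler_sum => n _; exact: cos_max.
Qed.

(** Used to cut a range of summation where the increments of the phase cross a level; [k = b] if
    they never reach it. *)
Lemma monotone_threshold (R : realDomainType) (d : nat -> R) (c : R) (a b : nat) :
  (a <= b)%N ->
  (forall n, (a <= n)%N -> (n.+1 < b)%N -> d n <= d n.+1) ->
  exists k, [/\ (a <= k <= b)%N, forall n, (a <= n < k)%N -> d n < c
    & forall n, (k <= n < b)%N -> c <= d n].
Proof.
move=> ab; have [k ->] : exists k, b = (a + k)%N by exists (b - a)%N; lia.
elim: k => [|k IH] dm; first by exists a; split => [|n|n]; lia.
rewrite addnS in dm *.
have [n an nb|j [/andP[aj jb] jl jr]] := IH; first by apply: dm; lia.
have [jk|kj] := ltnP j (a + k)%N.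
  exists j; split => [||n /andP[jn]]; [lia|exact: jl|].
  rewrite ltnS leq_eqVlt => /orP[/eqP ->|nk]; last by apply: jr; lia.
  have e : (a + k = (a + k).-1.+1)%N by lia.
  rewrite e (le_trans (jr (a + k).-1 _)) //; first by lia.
  by apply: dm; lia.
have {jb kj} jE : j = (a + k)%N by lia.
rewrite {}jE in aj jl jr.
have [dk|kd] := ltP (d (a + k)%N) c.
  exists (a + k).+1; split => [|n /andP[an]|n]; [lia| |lia].
  by rewrite ltnS leq_eqVlt => /orP[/eqP -> //|nk]; apply: jl; lia.
exists (a + k)%N; split => [|//|n nk]; first lia.
by have -> : n = (a + k)%N by lia.
Qed.

(** Over [b - a - 1] steps [d] climbs by at least [mu] each time, inside an interval of length [h];
    the starting point accounts for the [+ 1]. *)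
Lemma separated_count_le (R : realFieldType) (d : nat -> R) (mu c h : R) (a b : nat) :
  0 < mu -> 0 <= h ->
  (forall n, (a <= n)%N -> (n.+1 < b)%N -> d n + mu <= d n.+1) ->
  (forall n, (a <= n < b)%N -> c <= d n <= c + h) ->
  (b - a)%:R <= h / mu + 1.
Proof.
move=> mu0 h0 dmu dch.
have hmu : 0 <= h / mu by rewrite divr_ge0 // ltW.
have [ba|ab] := leqP b a.
  by have -> : (b - a = 0)%N; [lia|lra].
have H k : (a + k < b)%N -> d a + k%:R * mu <= d (a + k)%N.
  elim: k => [|k IH] kb; first by rewrite addn0; lra.
  rewrite addnS in kb *; have := IH (ltnW kb); have := dmu (a + k)%N.
  rewrite leq_addr kb -natr1 => /(_ isT isT); lra.
have [k kb] : exists k, b = (a + k).+1 by exists (b - a.+1)%N; lia.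
have -> : (b - a = k.+1)%N by lia.
rewrite -natr1 lerD2r ler_pdivlMr //.
have := H k; have := dch a; have := dch (a + k)%N.
have -> : (a <= a + k < b)%N by lia.
have -> : (a <= a < b)%N by lia.
have -> : (a + k < b)%N by lia.
by move=> /(_ isT)/andP[? ?] /(_ isT)/andP[? ?] /(_ isT) ?; lra.
Qed.

Lemma van_der_corput_unit (R : realType) (f : nat -> R) (L : R) (a b : nat) : 1 <= L ->
  (forall n, (a <= n)%N -> (n.+1 < b)%N ->
     f n.+1 - f n + L ^- 2 <= f n.+2 - f n.+1) ->
  (forall n, (a <= n < b)%N -> 0 <= f n.+1 - f n < 1) ->
  `|\sum_(a <= n < b) cos (2 * pi * f n)| <= 6 * L.
Proof.
move=> L1 fc f01.
have L0 : 0 < L by lra.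
have L2 : 0 < L ^- 2 by rewrite invr_gt0 exprn_gt0.
have [ba|ab] := leqP b a; first by rewrite big_geq // normr0; lra.
(* This scale balances the two bounds: increments within [l] of 0 or of 1 occur at most
   [l / L ^- 2 + 1 = L / 2 + 1] times each, and Kusmin-Landau gives [1 + 4 * L / pi <= 1 + 2 * L] in
   between. The total [3 * L + 3] is at most [6 * L]. *)
pose l := (2 * L)^-1.
have l0 : 0 < l by rewrite invr_gt0; lra.
have lL : l / L ^- 2 = L / 2 by rewrite /l; field; rewrite gt_eqF.
have Ml : l <= 1 / 2.
  by rewrite /l div1r lef_pV2 ?posrE; lra.
pose d n := f n.+1 - f n.
have dm n : (a <= n)%N -> (n.+1 < b)%N -> d n <= d n.+1.
  by move=> an nb; have := fc n an nb; rewrite /d; lra.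
have [j [/andP[aj jb] jl jr]] := monotone_threshold l (ltnW ab) dm.
have [k [/andP[jk kb] kl kr]] : exists k, [/\ (j <= k <= b)%N,
    forall n, (j <= n < k)%N -> d n < 1 - l & forall n, (k <= n < b)%N -> 1 - l <= d n].
  by apply: monotone_threshold => // n jn nb; apply: dm; lia.
rewrite (@big_cat_nat _ _ _ j) //= (@big_cat_nat _ _ _ k j) //=.
have S1 : `|\sum_(a <= n < j) cos (2 * pi * f n)| <= L / 2 + 1.
  rewrite (le_trans (norm_sum_cos_le _ _ _)) // -lL.
  apply: (@separated_count_le _ d _ 0) => // [|n an nj|n anj]; first exact: ltW.
    by rewrite /d; apply: fc; lia.
  have /andP[? ?] : 0 <= d n < 1 by apply: f01; lia.
  by have := jl n anj; lra.
have S3 : `|\sum_(k <= n < b) cos (2 * pi * f n)| <= L / 2 + 1.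
  rewrite (le_trans (norm_sum_cos_le _ _ _)) // -lL.
  apply: (@separated_count_le _ d _ (1 - l)) => // [|n an nj|n anj]; first exact: ltW.
    by rewrite /d; apply: fc; lia.
  have /andP[? ?] : 0 <= d n < 1 by apply: f01; lia.
  by have := kr n anj; lra.
have S2 : `|\sum_(j <= n < k) cos (2 * pi * f n)| <= 1 + 2 * L.
  apply: le_trans (kusmin_landau l0 _ _) _ => [n jn nk|n /andP[jn nk]|].
  - by apply: dm; lia.
  - rewrite -/(d n) jr ?ltW ?kl ?jn //; lia.
  have pi2 := pi_ge2 R.
  have -> : 2 / (pi * l) = 4 * L / pi.
    by rewrite /l; field; rewrite !gt_eqF //; lra.
  rewrite lerD2l ler_pdivrMr; last lra.
  have : 2 * L * 2 <= 2 * L * pi by rewrite ler_pM2l //; lra.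
  by lra.
apply: le_trans (ler_normD _ _) _.
have := ler_normD (\sum_(j <= n < k) cos (2 * pi * f n))
  (\sum_(k <= n < b) cos (2 * pi * f n)); lra.
Qed.

(** Induction on [K]: the range is cut where the increments reach 1. On the right part [n] is
    subtracted from [f n], which lowers every increment by 1 and leaves the cosines unchanged. *)
Lemma van_der_corput (R : realType) (f : nat -> R) (L : R) (K a b : nat) : 1 <= L ->
  (forall n, (a <= n)%N -> (n.+1 < b)%N ->
     f n.+1 - f n + L ^- 2 <= f n.+2 - f n.+1) ->
  (forall n, (a <= n < b)%N -> 0 <= f n.+1 - f n < K%:R) ->
  `|\sum_(a <= n < b) cos (2 * pi * f n)| <= K%:R * (6 * L).
Proof.
move=> L1.
have L2 : 0 < L ^- 2 by rewrite invr_gt0 exprn_gt0; lra.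
elim: K f a => [|K IH] f a fc fK.
  have [ba|ab] := leqP b a; first by rewrite big_geq // normr0 mul0r.
  by have /fK/andP[? ?] : (a <= a < b)%N; [lia|lra].
have [ba|ab] := leqP b a.
  by rewrite big_geq // normr0 !mulr_ge0 ?ler0n //; lra.
have [n an nb|k [/andP[ak kb] kl kr]] :=
    @monotone_threshold _ (fun n => f n.+1 - f n) 1 a b (ltnW ab).
  by have := fc n an nb; lra.
rewrite (@big_cat_nat _ _ _ k) //=.
have S1 : `|\sum_(a <= n < k) cos (2 * pi * f n)| <= 6 * L.
  apply: van_der_corput_unit => // n; first by move=> an nk; apply: fc; lia.
  move=> ank; rewrite kl // andbT.
  by have /fK/andP[] : (a <= n < b)%N by lia.
have S2 : `|\sum_(k <= n < b) cos (2 * pi * f n)| <= K%:R * (6 * L).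
  have -> : \sum_(k <= n < b) cos (2 * pi * f n)
      = \sum_(k <= n < b) cos (2 * pi * (f n - n%:R)).
    apply: eq_bigr => n _; rewrite -[RHS](cosD2piz _ n).
    by congr cos; ring.
  apply: IH => n.
    move=> kn nb; have := fc n; rewrite nb (leq_trans ak kn) => /(_ isT isT).
    by rewrite -!natr1; lra.
  move=> knb; have := kr n knb.
  have /fK/andP[_] : (a <= n < b)%N by lia.
  by rewrite -!natr1; lra.
by apply: le_trans (ler_normD _ _) _; rewrite -natr1; lra.
Qed.

(** * Inequalities for powers and the splitting of the exponential sum *)

(** Young's inequality for [y] and [z ^ (p - 1)] with exponents [p] and [p / (p - 1)], multiplied by
    [p]. The case [p = 1] is separate, having no finite conjugate exponent. *)
Lemma powR_tangent_le (R : realType) (p y z : R) : 1 <= p -> 0 <= y -> 0 <= z ->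
  z `^ p + p * z `^ (p - 1) * (y - z) <= y `^ p.
Proof.
move=> p1 y0 z0.
have zz : z * z `^ (p - 1) = z `^ p by rewrite mulr_powRB1; lra.
have [pE|pn1] := eqVneq p 1.
  by rewrite pE subrr powRr0 !powRr1 //; lra.
have p1' : 1 < p by rewrite lt_neqAle eq_sym pn1.
have q0 : 0 < p / (p - 1) by rewrite divr_gt0; lra.
have := @conjugate_powR R y (z `^ (p - 1)) p (p / (p - 1)) y0 (powR_ge0 _ _).
rewrite -powRrM.
have -> : (p - 1) * (p / (p - 1)) = p by field; lra.
have p0 : 0 < p by lra.
have -> : p^-1 + (p / (p - 1))^-1 = 1 by field; apply/andP; split; lra.
move=> /(_ p0 q0 erefl); rewrite -(ler_pM2l p0).
have -> : p * (y `^ p / p + z `^ p / (p / (p - 1))) = y `^ p + (p - 1) * z `^ p.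
  by field; apply/andP; split; lra.
by rewrite mulrBr -[_ * _ * z]mulrA [_ * z]mulrC zz; lra.
Qed.

Lemma sum_symmetric (V : nmodType) (F : int -> V) (N : nat) :
  \sum_(i < (2 * N).+1) F (i%:Z - N%:Z)
  = \sum_(0 <= n < N.+1) F n%:Z + \sum_(0 <= n < N) F (- n.+1%:Z).
Proof.
rewrite -(big_mkord xpredT (fun i => F (i%:Z - N%:Z))).
rewrite (@big_cat_nat _ _ _ N) //=; last by lia.
rewrite addrC; congr (_ + _).
  rewrite -{1}[N]add0n big_addn.
  have -> : ((2 * N).+1 - N = N.+1)%N by lia.
  by apply: eq_big_nat => n _; congr F; lia.
rewrite big_nat_rev /=; apply: eq_big_nat => n nN; congr F; lia.
Qed.

Lemma normC_le_ReIm (R : rcfType) (z : R[i]) (a b : R) :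
  `|complex.Re z| <= a -> `|complex.Im z| <= b -> `|z| <= (a + b)%:C.
Proof.
move=> za zb; rewrite normc_def lecR.
have a0 := le_trans (normr_ge0 _) za; have b0 := le_trans (normr_ge0 _) zb.
rewrite -[leRHS]ger0_norm ?addr_ge0 // -sqrtr_sqr ler_wsqrtr //.
rewrite -[X in X + _]real_normK ?num_real // -[X in _ + X]real_normK ?num_real //.
rewrite (@le_trans _ _ (a ^+ 2 + b ^+ 2)) //.
  by rewrite lerD // lerXn2r ?nnegrE.
by have := mulr_ge0 a0 b0; rewrite sqrrD; lra.
Qed.

Lemma Re_exp_sum (R : realType) (theta t x : R) (N : nat) :
  complex.Re (exp_sum theta N t x) = \sum_(i < (2 * N).+1)
    cos (2 * pi * (x * (i%:Z - N%:Z)%:~R + t * `|(i%:Z - N%:Z)%:~R| `^ theta)).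
Proof.
rewrite /exp_sum raddf_sum; apply: eq_bigr => i _ /=.
by rewrite expR0 mul1r mul0r subr0.
Qed.

Lemma Im_exp_sum (R : realType) (theta t x : R) (N : nat) :
  complex.Im (exp_sum theta N t x) = \sum_(i < (2 * N).+1)
    sin (2 * pi * (x * (i%:Z - N%:Z)%:~R + t * `|(i%:Z - N%:Z)%:~R| `^ theta)).
Proof.
rewrite /exp_sum raddf_sum; apply: eq_bigr => i _ /=.
by rewrite expR0 mul1r mul0r addr0.
Qed.

(* The tangent line at [m^2] bounds the power [theta / 2] at [(m + 1)^2] and
   [(m - 1)^2]; the terms linear in [m] cancel, and [(m + 1)^2 + (m - 1)^2 = 2 m^2 + 2]. *)
Lemma powR_second_difference (R : realType) (theta m : R) : 2 <= theta -> 1 <= m ->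
  theta * m `^ (theta - 2) + 2 * m `^ theta
  <= (m + 1) `^ theta + (m - 1) `^ theta.
Proof.
move=> th2 m1.
have sq (y q : R) : 0 <= y -> y `^ (2 * q) = (y ^+ 2) `^ q.
  by move=> y0; rewrite powRrM powR_mulrn.
have -> : theta = 2 * (theta / 2) by lra.
have -> : 2 * (theta / 2) - 2 = 2 * (theta / 2 - 1) by ring.
rewrite !sq; try lra.
have p1 : 1 <= theta / 2 by lra.
have := powR_tangent_le p1 (sqr_ge0 (m + 1)) (sqr_ge0 m).
have := powR_tangent_le p1 (sqr_ge0 (m - 1)) (sqr_ge0 m).
by lra.
Qed.

Lemma powR_Ninv_ge1 (R : realType) (theta t : R) (N : nat) :
  1 <= theta -> (0 < N)%N -> 0 < t -> t <= N%:R `^ (- (theta - 1)) ->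
  1 <= t `^ (- (1 / theta)).
Proof.
move=> th1 N0 t0 tN.
have t1 : t <= 1.
  apply: le_trans tN _; rewrite -[leRHS](powRr0 N%:R) ler_powR ?ler1n //; lra.
rewrite -[leLHS](powRr0 t) ger_powR ?t0 // oppr_le0 divr_ge0 //; lra.
Qed.

(** * Bounds for the phase of the theorem *)

Lemma norm_sum_cos_phase_le (R : realType) (theta c x t : R) (N : nat) :
  2 <= theta -> (0 < N)%N -> 0 < t -> t <= N%:R `^ (- (theta - 1)) ->
  `|\sum_(0 <= n < N.+1) cos (2 * pi * (c + x * n%:R + t * n%:R `^ theta))|
  <= (6 * (Num.bound theta).+1%:R + 3) * t `^ (- (1 / theta)).
Proof.
move=> th2 N0 t0 tN.
pose L := t `^ (- (1 / theta)).
have L1 : 1 <= L by apply: (powR_Ninv_ge1 _ N0); lra.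
(* This holds because [L ^ theta = 1 / t]. *)
have tL : t * L `^ (theta - 2) = L ^- 2.
  rewrite powRB; last by rewrite (gt_eqF (_ : 0 < L)) ?implybT //; lra.
  rewrite powR_mulrn; last by lra.
  rewrite /L -powRrM mulNr div1r mulVf ?powR_inv1; try lra.
  by rewrite mulrA mulfV ?mul1r //; lra.
(* Replacing [x] by its fractional part changes the phase by integers only, and makes the increments
   of [f] nonnegative and bounded independently of [x]. *)
pose f n := c + (x - (Num.floor x)%:~R) * n%:R + t * n%:R `^ theta.
have -> : \sum_(0 <= n < N.+1) cos (2 * pi * (c + x * n%:R + t * n%:R `^ theta))
    = \sum_(0 <= n < N.+1) cos (2 * pi * f n).
  apply: eq_bigr => n _; rewrite -[RHS](cosD2piz _ (Num.floor x * n%:Z)).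
  by congr cos; rewrite /f intrM; ring.
have /andP[x0 x1] := floor_itv x; rewrite intrD in x1.
have df n : f n.+1 - f n = x - (Num.floor x)%:~R
    + t * (n.+1%:R `^ theta - n%:R `^ theta).
  by rewrite /f -natr1; ring.
(* The second difference of the power, centred at [n + 1], is at least
   [theta * (n + 1) ^ (theta - 2)]; the factor [theta >= 1] is dropped. *)
have fc n : L <= n.+1%:R -> f n.+1 - f n + L ^- 2 <= f n.+2 - f n.+1.
  move=> Ln; rewrite !df -tL.
  have n1 : 1 <= n.+1%:R :> R by rewrite ler1n.
  have := powR_second_difference th2 n1; rewrite natr1 -[X in X - 1]natr1 addrK => H.
  have Lm : L `^ (theta - 2) <= n.+1%:R `^ (theta - 2).
    by rewrite ge0_ler_powR ?nnegrE //; lra.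
  have {}H : L `^ (theta - 2) <= n.+2%:R `^ theta - n.+1%:R `^ theta
      - (n.+1%:R `^ theta - n%:R `^ theta).
    have : 0 <= (theta - 1) * n.+1%:R `^ (theta - 2).
      by rewrite mulr_ge0 ?powR_ge0 //; lra.
    lra.
  by rewrite -(ler_pM2l t0) in H; lra.
(* The fractional part is below 1, and by convexity the power part is at most
   [t * theta * N ^ (theta - 1) <= theta]. *)
have fK n : (n < N)%N -> 0 <= f n.+1 - f n < (Num.bound theta).+1%:R.
  move=> nN; rewrite df.
  have KE : (Num.bound theta)%:R + 1 = (Num.bound theta).+1%:R :> R := natr1 _.
  have thb : theta < (Num.bound theta)%:R by apply: archi_boundP; lra.
  have up : n%:R `^ theta <= n.+1%:R `^ theta.
    by rewrite ge0_ler_powR ?nnegrE ?ler_nat //; lra.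
  have dn : n.+1%:R `^ theta - n%:R `^ theta <= theta * N%:R `^ (theta - 1).
    apply: (@le_trans _ _ (theta * n.+1%:R `^ (theta - 1))).
      have := @powR_tangent_le _ theta n%:R n.+1%:R.
      move=> /(_ ltac:(lra) (ler0n _ _) (ler0n _ _)).
      have -> : n%:R - n.+1%:R = -1 :> R by rewrite -natr1; ring.
      by rewrite mulrN1; lra.
    rewrite ler_wpM2l ?ge0_ler_powR ?nnegrE ?ler_nat //; lra.
  have tN1 : t * N%:R `^ (theta - 1) <= 1.
    rewrite -ler_pdivlMr; last by rewrite powR_gt0 ?ltr0n.
    by rewrite div1r -powRN.
  have lo : 0 <= t * (n.+1%:R `^ theta - n%:R `^ theta).
    by rewrite mulr_ge0 ?subr_ge0 // ltW.
  have hi : t * (n.+1%:R `^ theta - n%:R `^ theta) <= theta.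
    apply: (@le_trans _ _ (theta * (t * N%:R `^ (theta - 1)))).
      by rewrite mulrCA ler_pM2l.
    have th0 : 0 <= theta by lra.
    by have := ler_wpM2l th0 tN1; rewrite mulr1.
  by apply/andP; split; lra.
set K := (Num.bound theta).+1 in fK *.
have K0 : 0 <= K%:R * (6 * L) by rewrite !mulr_ge0 ?ler0n //; lra.
(* With [L <= a <= L + 1], the trivial bound on the first [a] terms and on the isolated last term
   costs [L + 2 <= 3 * L]. *)
pose a := (Num.truncn L).+1.
have aL : a%:R <= L + 1 by rewrite -natr1 lerD2r truncn_le; lra.
have La : L <= a%:R by apply: ltW; apply: real_truncnS_gt; apply: num_real.
rewrite -/L.
have [Na|aN] := ltnP N a.
  apply: le_trans (norm_sum_cos_le _ _ _) _; rewrite subn0.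
  have : N.+1%:R <= a%:R :> R by rewrite ler_nat.
  lra.
(* The term [n = N] is split off because its increment would involve [N + 1], beyond the reach of
   [fK]. *)
rewrite big_nat_recr //= (@big_cat_nat _ _ _ a) //=.
have S1 : `|\sum_(0 <= n < a) cos (2 * pi * f n)| <= a%:R.
  by rewrite (le_trans (norm_sum_cos_le _ _ _)) // subn0.
have S2 : `|\sum_(a <= n < N) cos (2 * pi * f n)| <= K%:R * (6 * L).
  apply: van_der_corput => // n; last by move=> /andP[_]; exact: fK.
  by move=> an _; apply: fc; rewrite (le_trans La) // ler_nat; lia.
have S3 := cos_max (2 * pi * f N).
apply: le_trans (ler_normD _ _) _.
have := ler_normD (\sum_(0 <= n < a) cos (2 * pi * f n))
  (\sum_(a <= n < N) cos (2 * pi * f n)); lra.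
Qed.

Lemma norm_sum_cos_symmetric_le (R : realType) (theta c x t : R) (N : nat) :
  2 <= theta -> (0 < N)%N ->
  - (N%:R `^ (- (theta - 1))) <= t <= N%:R `^ (- (theta - 1)) -> t != 0 ->
  `|\sum_(i < (2 * N).+1) cos (2 * pi * (c
      + (x * (i%:Z - N%:Z)%:~R + t * `|(i%:Z - N%:Z)%:~R| `^ theta)))|
  <= (12 * (Num.bound theta).+1%:R + 7) * `|t| `^ (- (1 / theta)).
Proof.
(* Negating [c], [x] and [t] together negates the phase, and the cosine is even. *)
move=> th2 N0 tN tn0; wlog t0 : c x t tN tn0 / 0 < t.
  move=> H; have [/H|t0|tE] := ltgtP 0 t; first exact.
    have := H (- c) (- x) (- t); rewrite oppr_gt0 oppr_eq0 normrN lerN2 lerNl andbC.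
    move=> /(_ tN tn0 t0); congr (`| _ | <= _); apply: eq_bigr => i _.
    by rewrite -cosN; congr cos; ring.
  by rewrite -tE eqxx in tn0.
move: tN => /andP[_ tN]; rewrite (gtr0_norm t0).
pose F (z : int) := cos (2 * pi * (c + (x * z%:~R + t * `|z%:~R| `^ theta))) : R.
rewrite (sum_symmetric F).
have P := norm_sum_cos_phase_le c x th2 N0 t0 tN.
have M := norm_sum_cos_phase_le c (- x) th2 N0 t0 tN.
have PE : \sum_(0 <= n < N.+1) F n%:Z
    = \sum_(0 <= n < N.+1) cos (2 * pi * (c + x * n%:R + t * n%:R `^ theta)).
  by apply: eq_bigr => n _; rewrite /F normr_nat addrA.
(* The negative frequencies become a sum with [- x] for [x], completed by the zero frequency.
   Removing that extra term costs 1, whence [2 * (6 * K + 3) + 1 = 12 * K + 7] with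
   [K = (Num.bound theta).+1]. *)
have ME : \sum_(0 <= n < N) F (- n.+1%:Z)
    = \sum_(0 <= n < N.+1) cos (2 * pi * (c + - x * n%:R + t * n%:R `^ theta)) - F 0.
  rewrite big_nat_recl //= /F normr0 !mulr0 add0r addr0 addrAC subrr add0r.
  apply: eq_bigr => n _.
  by rewrite mulrNz normrN normr_nat mulrN mulNr addrA.
have F0 : `|F 0| <= 1 by exact: cos_max.
rewrite PE ME.
set S := (X in `|X| <= _) in P; set T := (X in `|X| <= _) in M.
rewrite -/S -/T.
have t1 : 1 <= t `^ (- (1 / theta)) by apply: (powR_Ninv_ge1 _ N0); lra.
have := ler_normD S (T - F 0); have := ler_normB T (F 0); lra.
Qed.

Theorem proposition4p1 (R : realType) (theta : R) (htheta : 2 <= theta) :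
  exists C : R, 0 < C /\
    forall (N : nat) (t x : R), (1 < N)%N ->
      - (N%:R `^ (- (theta - 1))) <= t <= N%:R `^ (- (theta - 1)) ->
      t != 0 ->
      `|exp_sum theta N t x| <= (C * `|t| `^ (- (1 / theta)))%:C.
Proof.
pose D : R := 12 * (Num.bound theta).+1%:R + 7.
have D0 : 0 < D by rewrite /D ltr_wpDl // mulr_ge0.
(* One [D] bounds the real part, the other the imaginary part. *)
exists (D + D); split => [|N t x N1 tN t0]; first by rewrite addr_gt0.
rewrite mulrDl; apply: normC_le_ReIm.
  rewrite Re_exp_sum.
  under eq_bigr do rewrite -[x * _ + _]add0r.
  exact: norm_sum_cos_symmetric_le (ltnW N1) tN t0.
rewrite Im_exp_sum.
have := norm_sum_cos_symmetric_le (- 4^-1) x htheta (ltnW N1) tN t0.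
congr (`| _ | <= _); apply: eq_bigr => i _.
by rewrite -cosBpihalf; congr cos; field.
Qed.
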